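(* Let $A\in\mathbb{C}_d[z,z^{-1}]$ satisfy $A^{\rm T}=A$ and be invertible on the unit circle, with partial indices $\mathcal{K}=\{\kappa_1\ge\dots\ge\kappa_d\}$. Then there exists a factorization $A=A_+D_2A_+^{\rm T}$ with $A_+\in\mathbb{C}_d[z]$ invertible for all $|z|\le1$ and $$D_2=\sum_{m\in\mathcal{M}_+}\big(z^{\kappa_m}|\bar m\rangle\langle m|+z^{-\kappa_m}|m\rangle\langle\bar m|\big)+\sum_{m\in\mathcal{M}_0}|m\rangle\langle m|.$$
   Context: $\mathbb{C}_d[z,z^{-1}]$ denotes complex $d\times d$ matrix Laurent polynomials $\sum_r a_rz^r$; $\mathbb{C}_d[z]$ those with only nonnegative powers; $A^{\rm T}(z):=\sum_r a_r^{\rm T}z^{-r}$. A standard WH factorization of $A$ invertible on $|z|=1$ is $A=A_+DA_-$ with $A_+$ a polynomial in $z$ invertible for $|z|\le1$, $A_-$ a polynomial in $z^{-1}$ invertible for $|z^{-1}|\le1$, $D=\mathrm{diag}(z^{\kappa_1},\dots,z^{\kappa_d})$, $\kappa_1\ge\dots\ge\kappa_d$; the partial indices are unique and form $\mathcal{K}$. $\mathcal{M}_\pm=\{m:\pm\kappa_m>0\}$, $\mathcal{M}_0=\{m:\kappa_m=0\}$, $\bar m=d+1-m$, $|m\rangle\langle m'|$ the matrix unit at $(m,m')$. *)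

(* Defs.v *)
From HB Require Import structures.
From mathcomp Require Import all_boot all_order all_algebra.
From mathcomp Require Import complex.
From mathcomp Require Import reals.
Set Implicit Arguments. Unset Strict Implicit. Unset Printing Implicit Defensive.
Import Order.TTheory GRing.Theory Num.Theory.
Local Open Scope ring_scope.

Definition evalmx (F : nzRingType) (d : nat) (P : 'M[{poly F}]_d) (z : F) : 'M[F]_d :=
  map_mx (fun p => p.[z]) P.

(* A matrix Laurent polynomial  A(z) = z^{-N} P(z),  P a matrix polynomial.
   Every element of C_d[z,z^{-1}] has this form. *)
Record lmx (F : nzRingType) (d : nat) := LMx { lmx_shift : nat; lmx_poly : 'M[{poly F}]_d }.

(* value of the Laurent polynomial at z (meaningful for z <> 0) *)
Definition lmx_eval (F : fieldType) (d : nat) (A : lmx F d) (z : F) : 'M[F]_d :=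
  (z ^- lmx_shift A) *: evalmx (lmx_poly A) z.

(* A^T(z) = sum_r a_r^T z^{-r} = (A(z^{-1}))^T *)
Definition lmx_symmetric (F : fieldType) (d : nat) (A : lmx F d) : Prop :=
  forall z : F, z != 0 -> (lmx_eval A z^-1)^T = lmx_eval A z.

Definition Dkappa (F : fieldType) (d : nat) (kappa : 'I_d -> int) (z : F) : 'M[F]_d :=
  \matrix_(i, j) (if i == j then z ^ (kappa i) else 0).

(* Standard Wiener-Hopf factorization A = A_+ D A_- with partial indices kappa
   (indices 0-based: m in 'I_d, nonincreasing). A_+ is given by a matrix
   polynomial Pp in z; A_- by a matrix polynomial Pm in z^{-1}, i.e.
   A_-(z) = Pm(z^{-1}). *)
Definition std_WH (R : realType) (d : nat) (A : lmx R[i] d) (kappa : 'I_d -> int) : Prop :=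
  (forall i j : 'I_d, (i <= j)%N -> kappa j <= kappa i) /\
  exists Pp Pm : 'M[{poly R[i]}]_d,
    (forall z : R[i], `|z| <= 1 -> evalmx Pp z \in unitmx) /\
    (forall w : R[i], `|w| <= 1 -> evalmx Pm w \in unitmx) /\
    (forall z : R[i], z != 0 ->
       lmx_eval A z = evalmx Pp z *m Dkappa kappa z *m evalmx Pm z^-1).

(* bar m = d + 1 - m in 1-based indexing, i.e. rev_ord m in 0-based indexing;
   |m><m'| = delta_mx m m'.
   D_2 = sum_{m in M_+} (z^{kappa_m} |bar m><m| + z^{-kappa_m} |m><bar m|)
         + sum_{m in M_0} |m><m|  *)
Definition D2 (F : fieldType) (d : nat) (kappa : 'I_d -> int) (z : F) : 'M[F]_d :=
  \sum_(m : 'I_d | 0 < kappa m)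
      (z ^ (kappa m) *: delta_mx (rev_ord m) m + z ^ (- kappa m) *: delta_mx m (rev_ord m))
  + \sum_(m : 'I_d | kappa m == 0) delta_mx m m.

(* Main.v *)
Require Import Defs.
From HB Require Import structures.
From mathcomp Require Import all_boot all_order all_algebra.
From mathcomp Require Import complex.
From mathcomp Require Import reals.
From mathcomp Require Import fingroup perm zify ring.
Import Order.TTheory GRing.Theory Num.Theory.
Local Open Scope ring_scope.

(** Write [~] for transposition combined with [z -> 1/z].  Comparing [A = P D M_-] with its [~] gives
    [M_-~ = P U], where [U] is analytic in the closed disc and [U D^-1 = D U~], i.e.
    [U_ij(z) = z^(k_i + k_j) U_ji(1/z)].  Hence [U] is a polynomial matrix, [det U] is constant,
    [U_ij = 0] when [k_i + k_j < 0], and so [k_(bar i) = - k_i] and [D2 = S D] for a permutation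
    matrix [S] with [S^2 = 1] and [S D S = D^-1].  With [V = U S] and [E = D S] one has
    [A = P V E P~] and [V E = E V~].  So [V(z)] and [V(1/z)] have the same characteristic polynomial,
    which is therefore independent of [z] and nonzero at 0; a constant-coefficient polynomial [p] with
    [p^2 = X] modulo it gives a square root [Q = p(V)] of [V] with [Q E = E Q~].  Thus
    [V E = Q E Q~ = (Q S) D2 (Q S)~], and [A_+ = P Q S]. *)

(** * Scalar polynomials under [z -> 1/z] *)

(** If [p - q] were nonzero, [(p - q) * 'X + 1] would be nonconstant and hence have a root; but its
    value is 1 at 0 by construction and 1 elsewhere by hypothesis. *)
Lemma closed_poly_inj (C : closedFieldType) (p q : {poly C}) :
  (forall z, z != 0 -> p.[z] = q.[z]) -> p = q.
Proof.
move=> pq; apply/eqP; rewrite -subr_eq0; apply/negPn/negP => r0.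
have : size ((p - q) * 'X + 1%:P) != 1.
  by rewrite size_MXaddC (negPf r0) /= eqSS size_poly_eq0.
case/closed_rootP => z; rewrite rootE !hornerE => /eqP h.
have [z0|z0] := eqVneq z 0.
  by move: h; rewrite z0 mulr0 add0r => /eqP; rewrite oner_eq0.
by move: h; rewrite pq // subrr mul0r add0r => /eqP; rewrite oner_eq0.
Qed.

Lemma reciprocal_poly (F : fieldType) (p : {poly F}) :
  exists n (q : {poly F}), (size q <= n.+1)%N /\
    forall z, z != 0 -> q.[z] = z ^+ n * p.[z^-1].
Proof.
elim/poly_ind: p => [|p c [n [q [sq Eq]]]].
  by exists 0%N, 0; split=> [|z _]; rewrite ?size_poly0 // !horner0 mulr0.
exists n.+1, (q + c *: 'X^(n.+1)); split.
  rewrite (leq_trans (size_polyD _ _)) // geq_max (leq_trans sq) //=.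
  by rewrite (leq_trans (size_scale_leq _ _)) // size_polyXn.
move=> z z0; rewrite !hornerE Eq // exprS.
by field.
Qed.

(** Clearing denominators turns the right side into a polynomial of size at most [n.+1] that equals
    [p * 'X^(m + n)]. With [m = 0] this makes [p] constant; with [m > 0] it is contradictory. *)
Lemma reciprocal_size (C : closedFieldType) (p q : {poly C}) (m : nat) :
  (forall z, z != 0 -> p.[z] * z ^+ m = q.[z^-1]) ->
  p != 0 -> (size p + m <= 1)%N.
Proof.
move=> pq p0; have [n [r [sr Er]]] := reciprocal_poly C q.
have Er' : r = p * 'X^(m + n).
  apply: closed_poly_inj => z z0.
  by rewrite Er // -pq // !hornerE /= exprD; ring.
by move: sr; rewrite Er' size_mulXn // addnAC -add1n leq_add2r addnC.
Qed.

Lemma reciprocal_polyz (F : fieldType) (p : {poly F}) (k : int) :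
  exists n (q : {poly F}), forall z, z != 0 -> q.[z] = z ^+ n * (p.[z^-1] * z ^ k).
Proof.
have [n [q [_ Eq]]] := reciprocal_poly F p.
have [i [j kij]] : exists i j : nat, k = (i%:Z - j%:Z).
  by case: (intP k) => [|l|l]; [exists 0%N, 0%N | exists l.+1, 0%N
    | exists 0%N, l.+1]; rewrite ?subr0 ?sub0r.
exists (n + j)%N, (q * 'X^i) => z z0.
rewrite !(hornerM, hornerXn) Eq // kij expfzDr // -exprnN -exprnP exprD.
by field; rewrite expf_neq0.
Qed.

(** The zeros of [delta] lie outside the closed disc, and inversion sends them inside. So [delta] is
    coprime to its reversal [e] times any power of ['X], and Gauss's lemma applies. *)
Lemma reciprocal_dvdp (C : numClosedFieldType) (delta a b : {poly C}) (k : int) :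
  (forall z : C, `|z| <= 1 -> delta.[z] != 0) ->
  (forall z, z != 0 -> a.[z] * delta.[z^-1] = delta.[z] * (b.[z^-1] * z ^ k)) ->
  delta %| a.
Proof.
move=> del0 ab.
have [n [e [_ Ee]]] := reciprocal_poly C delta.
have [m [c Ec]] := reciprocal_polyz C b k.
have id : a * (e * 'X^m) = delta * (c * 'X^n).
  apply: closed_poly_inj => z z0; rewrite !(hornerM, hornerXn) Ee // Ec //.
  have -> : a.[z] * (z ^+ n * delta.[z^-1] * z ^+ m) =
     (a.[z] * delta.[z^-1]) * (z ^+ n * z ^+ m) by ring.
  by rewrite ab //; ring.
have cop : coprimep delta (e * 'X^m).
  apply/Pdiv.ClosedField.coprimepP => z rz.
  have z1 : 1 < `|z|.
    by rewrite real_ltNge ?num_real ?normr_real //; apply/negP => /del0/negP.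
  have z0 : z != 0 by rewrite -normr_gt0 (lt_trans _ z1).
  rewrite !hornerE Ee // !mulf_neq0 ?expf_neq0 //.
  by apply: del0; rewrite normfV invf_le1 ?normr_gt0 // ltW.
by rewrite -(Gauss_dvdpl _ cop) id dvdp_mulr.
Qed.

(** The factors may vanish at some [z], so the cancellation takes place in the domain of
    polynomials, after multiplying by powers of [z]. *)
Lemma reciprocal_cancel (C : closedFieldType) (delta a b : {poly C}) (k : int) :
  delta != 0 ->
  (forall z, z != 0 -> delta.[z] * delta.[z^-1] * (a.[z] - b.[z^-1] * z ^ k) = 0) ->
  forall z, z != 0 -> a.[z] = b.[z^-1] * z ^ k.
Proof.
move=> del0 ab z z0.
have [n [e [_ Ee]]] := reciprocal_poly C delta.
have [m [c Ec]] := reciprocal_polyz C b k.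
have e0 : e != 0.
  apply: contra_neq del0 => e0; apply: closed_poly_inj => w w0; rewrite horner0.
  have := Ee w^-1; rewrite e0 horner0 invrK invr_eq0 => /(_ w0)/esym/eqP.
  by rewrite mulf_eq0 expf_eq0 invr_eq0 (negPf w0) andbF => /eqP.
have /eqP : delta * e * (a * 'X^m - c) = 0.
  apply: closed_poly_inj => w w0.
  rewrite horner0 !(hornerM, hornerXn, hornerD, hornerN) Ee // Ec //.
  have -> : delta.[w] * (w ^+ n * delta.[w^-1]) *
      (a.[w] * w ^+ m - w ^+ m * (b.[w^-1] * w ^ k)) =
     delta.[w] * delta.[w^-1] * (a.[w] - b.[w^-1] * w ^ k) * (w ^+ n * w ^+ m)
    by ring.
  by rewrite ab // mul0r.
rewrite !mulf_eq0 (negPf del0) (negPf e0) /= subr_eq0 => /eqP ac.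
apply: (mulIf (expf_neq0 m z0)).
by have := Ec z z0; rewrite -ac !(hornerM, hornerXn) mulrC => ->; rewrite mulrC.
Qed.

(** * Square roots of ['X] modulo a polynomial *)

(* Newton-type lifting: one linear factor [X - a] at a time, correcting [p] by a scalar multiple of the modulus. *)
Lemma sqrtX_mod_prod (C : numClosedFieldType) (s : seq C) :
  0 \notin s -> exists p : {poly C}, \prod_(a <- s) ('X - a%:P) %| p ^+ 2 - 'X.
Proof.
elim: s => [|a s IH]; first by exists 0; rewrite big_nil dvd1p.
rewrite inE negb_or eq_sym => /andP[a0 /IH[p]]; rewrite big_cons.
set q := \prod_(_ <- s) _ => /dvdpP[r Er].
(* The left side is the value at [a] of the cofactor of [q] in [(p + c *: q) ^+ 2 - 'X]. If [a] is a
   repeated root, the equation is linear in [c] and solvable because [p.[a] ^+ 2 = a] is nonzero;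
   otherwise [c] makes [p + c *: q] take the value [sqrtC a] at [a]. *)
have [c rc] : exists c, r.[a] + 2 * p.[a] * c + q.[a] * c ^+ 2 = 0.
  have Era : p.[a] ^+ 2 - a = r.[a] * q.[a].
    by have := congr1 (fun f => f.[a]) Er; rewrite !hornerE.
  have [qa|qa] := eqVneq q.[a] 0.
    have pa : p.[a] != 0.
      apply: contra_neq a0 => pa; move: Era.
      by rewrite qa pa mulr0 expr0n /= sub0r => /eqP; rewrite oppr_eq0 => /eqP.
    exists (- r.[a] / (2 * p.[a])); rewrite qa.
    by field; rewrite pa.
  exists ((sqrtC a - p.[a]) / q.[a]); apply: (mulfI qa).
  have -> : q.[a] * (r.[a] + 2 * p.[a] * ((sqrtC a - p.[a]) / q.[a])
    + q.[a] * ((sqrtC a - p.[a]) / q.[a]) ^+ 2) =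
    (r.[a] * q.[a]) + (sqrtC a) ^+ 2 - p.[a] ^+ 2 by field.
  by rewrite -Era sqrtCK mulr0; ring.
exists (p + c *: q).
have -> : (p + c *: q) ^+ 2 - 'X = (r + (2 * c) *: p + c ^+ 2 *: q) * q.
  rewrite -!mul_polyC rmorphM rmorphXn rmorph_nat /=.
  have -> : (p + c%:P * q) ^+ 2 - 'X =
    (p ^+ 2 - 'X) + 2 * (c%:P * p * q) + c%:P ^+ 2 * q ^+ 2 by ring.
  by rewrite Er; ring.
apply: dvdp_mul => //; rewrite dvdp_XsubCl rootE !hornerE -{}rc.
by apply/eqP; ring.
Qed.

Lemma sqrtX_mod (C : numClosedFieldType) (q : {poly C}) :
  q`_0 != 0 -> exists p : {poly C}, q %| p ^+ 2 - 'X.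
Proof.
move=> q0; have [s Es] := closed_field_poly_normal q.
have nz : lead_coef q != 0.
  by rewrite lead_coef_eq0; apply: contraNneq q0 => ->; rewrite coef0.
have s0 : 0 \notin s.
  apply: contra q0 => s0; rewrite -horner_coef0 -rootE Es rootZ //.
  by rewrite root_prod_XsubC.
by have [p] := sqrtX_mod_prod C s s0; exists p; rewrite Es dvdpZl.
Qed.

(** * Evaluation, functional calculus and characteristic polynomials of polynomial matrices *)

Lemma evalmxM (F : comNzRingType) (d : nat) (P Q : 'M[{poly F}]_d) (z : F) :
  evalmx (P *m Q) z = evalmx P z *m evalmx Q z.
Proof. exact: (map_mxM (horner_eval z)). Qed.

Lemma det_evalmx (F : comNzRingType) (d : nat) (P : 'M[{poly F}]_d) (z : F) :
  \det (evalmx P z) = (\det P).[z].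
Proof. exact: (det_map_mx (horner_eval z)). Qed.

Lemma unitmx_evalmx (F : fieldType) (d : nat) (P : 'M[{poly F}]_d) (z : F) :
  (evalmx P z \in unitmx) = ((\det P).[z] != 0).
Proof. by rewrite unitmxE unitfE det_evalmx. Qed.

Lemma evalmx_tr (F : nzRingType) (d : nat) (P : 'M[{poly F}]_d) (z : F) :
  evalmx P^T z = (evalmx P z)^T.
Proof. by rewrite /evalmx map_trmx. Qed.

Lemma evalmxC (F : nzRingType) (d : nat) (S : 'M[F]_d) (z : F) :
  evalmx (map_mx polyC S) z = S.
Proof. by apply/matrixP=> i j; rewrite !mxE hornerC. Qed.

Lemma evalmx_horner_mx (F : comNzRingType) (n : nat) (V : 'M[{poly F}]_n.+1)
    (p : {poly F}) (z : F) :
  evalmx (horner_mx V (map_poly polyC p)) z = horner_mx (evalmx V z) p.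
Proof.
rewrite -[LHS]/(map_mx (horner_eval z) _) map_horner_mx -map_poly_comp.
by congr horner_mx; rewrite map_poly_id // => c _ /=; rewrite /horner_eval hornerC.
Qed.

Lemma horner_mx_intertwine (F : comNzRingType) (n : nat) (X Y E : 'M[F]_n.+1)
    (p : {poly F}) :
  X *m E = E *m Y -> horner_mx X p *m E = E *m horner_mx Y p.
Proof.
move=> XY; elim/poly_ind: p => [|p c IH]; first by rewrite !rmorph0 mul0mx mulmx0.
rewrite !rmorphD !rmorphM /= !horner_mx_X !horner_mx_C mulmxDl mulmxDr scalar_mxC.
by congr (_ + _); rewrite -!mulmxE -mulmxA XY mulmxA IH mulmxA.
Qed.

Lemma trmx_horner_mx (F : comNzRingType) (n : nat) (X : 'M[F]_n.+1) (p : {poly F}) :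
  (horner_mx X p)^T = horner_mx X^T p.
Proof.
elim/poly_ind: p => [|p c IH]; first by rewrite !rmorph0 trmx0.
rewrite !rmorphD !rmorphM /= !horner_mx_X !horner_mx_C linearD /= tr_scalar_mx.
rewrite -mulmxE trmx_mul IH; congr (_ + _).
(* Intertwining with all three matrices equal to [X^T] says that [X^T] commutes with its
   polynomials. *)
by rewrite (horner_mx_intertwine _ _ X^T X^T).
Qed.

Lemma char_poly_intertwine (F : fieldType) (n : nat) (X Y E : 'M[F]_n) :
  E \in unitmx -> X *m E = E *m Y -> char_poly X = char_poly Y.
Proof.
move=> Eu XY.
have : char_poly_mx X *m map_mx polyC E = map_mx polyC E *m char_poly_mx Y.
  by rewrite mulmxBl mulmxBr scalar_mxC -!map_mxM XY.
move/(congr1 determinant); rewrite !det_mulmx mulrC det_map_mx => h.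
by apply: mulfI h; rewrite polyC_eq0 -unitfE -unitmxE.
Qed.

Lemma char_poly_tr (F : comNzRingType) (n : nat) (X : 'M[F]_n) :
  char_poly X^T = char_poly X.
Proof.
by rewrite /char_poly -det_tr linearB /= tr_scalar_mx map_trmx trmxK.
Qed.

Lemma coef_char_poly_evalmx (F : comNzRingType) (d : nat) (V : 'M[{poly F}]_d)
    (z : F) k :
  (char_poly (evalmx V z))`_k = ((char_poly V)`_k).[z].
Proof. by rewrite -(map_char_poly (horner_eval z)) coef_map. Qed.

(** Each coefficient is a polynomial in [z] invariant under [z -> 1/z], hence constant. *)
Lemma char_poly_evalmx_const (C : closedFieldType) (d : nat) (V : 'M[{poly C}]_d) :
  (forall z, z != 0 -> char_poly (evalmx V z) = char_poly (evalmx V z^-1)) ->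
  forall z w, char_poly (evalmx V z) = char_poly (evalmx V w).
Proof.
move=> sym z w; apply/polyP => k; rewrite (coef_char_poly_evalmx _ _ V z) (coef_char_poly_evalmx _ _ V w).
set c := (char_poly V)`_k.
have [->|c0] := eqVneq c 0; first by rewrite !horner0.
have /size1_polyC -> : (size c <= 1)%N.
  rewrite -[size c]addn0; apply: (reciprocal_size C c c 0 _ c0) => x x0.
  rewrite expr0 mulr1 -(coef_char_poly_evalmx _ _ V x).
  by rewrite -(coef_char_poly_evalmx _ _ V x^-1) sym.
by rewrite !hornerC.
Qed.

(** One scalar [p] serves every [z], so the root [p(V)] is again a polynomial matrix;
    Cayley-Hamilton kills the modulus. *)
Lemma sqrt_evalmx (C : numClosedFieldType) (n : nat) (V : 'M[{poly C}]_n.+1) :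
  (forall z w, char_poly (evalmx V z) = char_poly (evalmx V w)) ->
  evalmx V 0 \in unitmx ->
  exists p : {poly C}, forall z, horner_mx (evalmx V z) p *m horner_mx (evalmx V z) p
    = evalmx V z.
Proof.
move=> Vc V0.
have [|p /dvdpP[q pq]] := sqrtX_mod C (char_poly (evalmx V 0)).
  by rewrite char_poly_det mulf_neq0 ?signr_eq0 // -unitfE -unitmxE.
exists p => z; have /(congr1 (horner_mx (evalmx V z))) := pq.
rewrite (Vc 0 z) rmorphM /= Cayley_Hamilton mulr0 rmorphB rmorphXn /= horner_mx_X.
by move/eqP; rewrite subr_eq0 expr2 => /eqP.
Qed.

(** * The diagonal factor *)

Lemma evalmxE (F : nzRingType) (d : nat) (P : 'M[{poly F}]_d) (z : F) i j :
  evalmx P z i j = (P i j).[z].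
Proof. by rewrite mxE. Qed.

Lemma mul_Dkappa (F : fieldType) (d : nat) (kappa : 'I_d -> int) (z : F) (X : 'M[F]_d) i j :
  (Dkappa kappa z *m X) i j = z ^ kappa i * X i j.
Proof.
rewrite mxE (bigD1 i) //= big1 ?addr0 => [|k ki]; first by rewrite mxE eqxx.
by rewrite mxE eq_sym (negPf ki) mul0r.
Qed.

Lemma mulmx_Dkappa (F : fieldType) (d : nat) (kappa : 'I_d -> int) (z : F) (X : 'M[F]_d) i j :
  (X *m Dkappa kappa z) i j = X i j * z ^ kappa j.
Proof.
rewrite mxE (bigD1 j) //= big1 ?addr0 => [|k kj]; first by rewrite mxE eqxx.
by rewrite mxE (negPf kj) mulr0.
Qed.

Lemma tr_Dkappa (F : fieldType) (d : nat) (kappa : 'I_d -> int) (z : F) :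
  (Dkappa kappa z)^T = Dkappa kappa z.
Proof.
by apply/matrixP=> i j; rewrite !mxE eq_sym; case: eqVneq => // ->.
Qed.

Lemma det_Dkappa (F : fieldType) (d : nat) (kappa : 'I_d -> int) (z : F) :
  z != 0 -> \det (Dkappa kappa z) = z ^ (\sum_i kappa i).
Proof.
move=> z0; have -> : Dkappa kappa z = diag_mx (\row_i z ^ kappa i).
  by apply/matrixP=> i j; rewrite !mxE; case: eqVneq => [->|]; rewrite ?mulr1n ?mulr0n.
rewrite det_diag; under eq_bigr do rewrite mxE.
by apply: (big_ind2 (fun x k => x = z ^ k)) => // x k y l -> ->; rewrite expfzDr.
Qed.

Lemma Dkappa_unit (F : fieldType) (d : nat) (kappa : 'I_d -> int) (z : F) :
  z != 0 -> Dkappa kappa z \in unitmx.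
Proof. by move=> z0; rewrite unitmxE det_Dkappa // unitfE expfz_neq0. Qed.

(** * The ratio of the two factors and the symmetry of the indices *)

(* [U = A_+^{-1} A_-^T] is a ratio of polynomials without poles in the closed disc; the symmetry forces
   its denominator to divide its numerator, as [det A_+(z)] and [det A_+(1/z)] have no common zero. *)
Lemma symmetric_WH_ratio (C : numClosedFieldType) (d : nat) (P M : 'M[{poly C}]_d)
    (kappa : 'I_d -> int) :
  (forall z : C, `|z| <= 1 -> evalmx P z \in unitmx) ->
  (forall z, z != 0 -> evalmx P z *m Dkappa kappa z *m evalmx M z^-1 =
     (evalmx P z^-1 *m Dkappa kappa z^-1 *m evalmx M z)^T) ->
  exists U : 'M[{poly C}]_d, M^T = P *m U /\
    forall z, z != 0 -> forall i j,
      (U i j).[z] = (U j i).[z^-1] * z ^ (kappa i + kappa j).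
Proof.
move=> Pu sym; set delta := \det P.
have del0 z : `|z| <= 1 -> delta.[z] != 0 by move/Pu; rewrite unitmx_evalmx.
have deln0 : delta != 0.
  by apply: contraTneq (del0 0 _) => [->|]; rewrite ?horner0 ?eqxx ?normr0 ?ler01.
(* [N] is [delta] times the ratio sought, so no fractions appear. *)
pose N := \adj P *m M^T.
have adjE z : evalmx (\adj P) z = \adj (evalmx P z).
  by rewrite /evalmx -(map_mx_adj (horner_eval z)).
have key z (z0 : z != 0) i j : (N i j).[z] * delta.[z^-1] =
    delta.[z] * ((N j i).[z^-1] * z ^ (kappa i + kappa j)).
  have /matrixP/(_ i j) : delta.[z^-1] *: (evalmx N z *m Dkappa kappa z^-1) =
      delta.[z] *: (Dkappa kappa z *m (evalmx N z^-1)^T).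
    rewrite !evalmxM !adjE !evalmx_tr !trmx_mul trmxK.
    (* Multiplying by the adjugates of [P(z)] and [P(1/z)^T] on the two sides leaves [N] on both
       sides, up to the scalars [delta]. *)
    have := sym z z0; rewrite !trmx_mul tr_Dkappa => /(congr1 (fun X =>
      \adj (evalmx P z) *m X *m (\adj (evalmx P z^-1))^T)).
    have -> : \adj (evalmx P z) *m
        (evalmx P z *m Dkappa kappa z *m evalmx M z^-1) *m (\adj (evalmx P z^-1))^T =
        delta.[z] *: (Dkappa kappa z *m (evalmx M z^-1 *m (\adj (evalmx P z^-1))^T)).
      by rewrite !mulmxA mul_adj_mx det_evalmx mul_scalar_mx -!scalemxAl.
    move=> ->; rewrite -!mulmxA -trmx_mul mul_adj_mx det_evalmx tr_scalar_mx.
    by rewrite !mul_mx_scalar -!scalemxAr.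
  rewrite mxE mulmx_Dkappa [in RHS]mxE mul_Dkappa [(_^T) i j]mxE !evalmxE => h.
  have zj : z ^ kappa j != 0 by rewrite expfz_neq0.
  have zzj : z ^ kappa j * z^-1 ^ kappa j = 1.
    by rewrite exprz_inv -expfzDr // subrr expr0z.
  rewrite expfzDr // -[LHS]mulr1 -zzj.
  transitivity (delta.[z^-1] * ((N i j).[z] * z^-1 ^ kappa j) * z ^ kappa j); first by ring.
  by rewrite h; ring.
have dvd i j : delta %| N i j.
  by apply: (reciprocal_dvdp C delta (N i j) (N j i) (kappa i + kappa j)) => // z z0;
     apply: key.
pose U : 'M_d := \matrix_(i, j) (N i j %/ delta).
have NU i j : N i j = U i j * delta by rewrite [U i j]mxE divpK.
exists U; split.
  have NU' : N = delta *: U by apply/matrixP=> i j; rewrite NU [RHS]mxE mulrC.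
  have : delta *: M^T = delta *: (P *m U).
    by rewrite scalemxAr -NU' mulmxA mul_mx_adj mul_scalar_mx.
  by move/matrixP=> h; apply/matrixP=> i j; apply: (mulfI deln0); have := h i j; rewrite !mxE.
move=> w w0 i j; apply: (reciprocal_cancel C delta) w0 => // z z0.
have /eqP := key z z0 i j; rewrite !NU !hornerM -subr_eq0 => /eqP <-.
by ring.
Qed.

(** Taking determinants in the symmetry, a zero of [\det U] outside the disc would reflect to one
    inside, where there is none. So [\det U] is a nonzero constant, and [z ^ (- s) = z ^ s] remains
    for the sum [s] of the indices. *)
Lemma reciprocal_det_const (C : numClosedFieldType) (d : nat) (U : 'M[{poly C}]_d)
    (kappa : 'I_d -> int) :
  (forall z : C, `|z| <= 1 -> evalmx U z \in unitmx) ->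
  (forall z, z != 0 ->
     evalmx U z *m Dkappa kappa z^-1 = Dkappa kappa z *m (evalmx U z^-1)^T) ->
  (forall z, evalmx U z \in unitmx) /\ \sum_i kappa i = 0.
Proof.
move=> Uu sym; set u := \det U; set s := \sum_i kappa i.
have us z : z != 0 -> u.[z] * z^-1 ^ s = z ^ s * u.[z^-1].
  move=> z0; have /(congr1 determinant) := sym z z0.
  by rewrite !det_mulmx det_tr !det_evalmx !det_Dkappa ?invr_neq0.
have u0 z : u.[z] != 0.
  have [/Uu|z1] := real_leP (normr_real z) (@real1 C); first by rewrite unitmx_evalmx.
  have z0 : z != 0 by rewrite -normr_gt0 (lt_trans _ z1).
  apply/eqP => uz; have /eqP := us z z0; rewrite uz mul0r eq_sym mulf_eq0.
  rewrite (negPf (expfz_neq0 s z0)) /= -det_evalmx; apply/negP.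
  rewrite -unitfE -unitmxE; apply: Uu.
  by rewrite normfV invf_le1 ?normr_gt0 // ltW.
split=> [z|]; first by rewrite unitmx_evalmx.
have [c uc] : exists c, u = c%:P.
  have [/eqP/size_poly1P[c _ ->]|/closed_rootP[z /rootP uz]] := eqVneq (size u) 1%N.
    by exists c.
  by have := u0 z; rewrite uz eqxx.
(* The point 2 suffices because its powers are pairwise distinct. *)
have two0 : (2 : C) != 0 by rewrite pnatr_eq0.
have c0 : c != 0 by have := u0 0; rewrite uc hornerC.
have /eqP := us 2 two0; rewrite uc !hornerC [_ ^ s * c]mulrC => /eqP/(mulfI c0)/eqP.
rewrite exprz_inv.
have exp2_eq n : (2 : C) ^- n == 2 ^+ n -> n = 0%N.
  move=> /eqP h; have : (2 : C) ^+ (n + n) == 1.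
    by rewrite exprD -{1}h mulVf // expf_neq0.
  by rewrite -natrX -[1]/(1%:R) eqr_nat -[1%N](expn0 2) eqn_exp2l // addn_eq0 => /andP[/eqP].
case: (intP s) => [//|n|n]; rewrite ?opprK -exprnN -exprnP => h.
  by rewrite (exp2_eq _ h).
by move: h; rewrite eq_sym => /exp2_eq ->; rewrite oppr0.
Qed.

(** If [kappa i + kappa (rev_ord i)] were negative, monotonicity would give [U] a zero block whose
    numbers of rows and columns add up to [d + 1], making it singular. These sums are thus
    nonnegative, and their total is twice the sum of the indices, which is 0. *)
Lemma antisymmetric_indices (C : closedFieldType) (d : nat) (U : 'M[{poly C}]_d)
    (kappa : 'I_d -> int) :
  (forall i j : 'I_d, (i <= j)%N -> kappa j <= kappa i) ->
  (forall z, z != 0 -> forall i j,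
     (U i j).[z] = (U j i).[z^-1] * z ^ (kappa i + kappa j)) ->
  \det U != 0 -> \sum_i kappa i = 0 ->
  forall i, kappa (rev_ord i) = - kappa i.
Proof.
move=> mono sym Udet sum0.
have U0 i j : kappa i + kappa j < 0 -> U i j = 0.
  move=> k0; apply/eqP/negPn/negP => Uij.
  have [n kn] : exists n : nat, kappa i + kappa j = - n.+1%:Z.
    by case: (intP (kappa i + kappa j)) k0 => // n _; exists n.
  suff /(reciprocal_size C (U i j) (U j i) n.+1)/(_ Uij) :
      forall z, z != 0 -> (U i j).[z] * z ^+ n.+1 = (U j i).[z^-1].
    by have := Uij; rewrite -size_poly_gt0; lia.
  move=> z z0; rewrite sym // kn -exprnN -mulrA mulVf ?mulr1 //.
  by rewrite expf_neq0.
have ge0 i : 0 <= kappa i + kappa (rev_ord i).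
  rewrite leNgt; apply: contra Udet => k0; apply/eqP; rewrite /determinant.
  apply: big1 => s _.
  (* pigeonhole: [s] cannot send the [d - i] rows [k >= i] into the [d - 1 - i] columns below [rev_ord i] *)
  have [k ik sk] : exists2 k : 'I_d, (i <= k)%N & (rev_ord i <= s k)%N.
    apply/exists_inP; apply: contraT => /exists_inPn lt_s.
    pose B := [set k : 'I_d | (i < k)%N].
    have sub : s @: (i |: B) \subset @rev_ord d @: B.
      apply/subsetP => _ /imsetP[k kB ->].
      have ik : (i <= k)%N by move: kB; rewrite !inE => /orP[/eqP->|/ltnW].
      apply/imsetP; exists (rev_ord (s k)); rewrite ?rev_ordK // inE /=.
      by have := lt_s k ik; rewrite -ltnNge /=; have := ltn_ord i; lia.
    have := subset_leq_card sub.
    rewrite (card_imset _ (@perm_inj _ s)) (card_imset _ rev_ord_inj).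
    by rewrite cardsU1 inE ltnn add1n ltnn.
  rewrite (bigD1 k) //= U0 ?mul0r ?mulr0 //.
  by apply: le_lt_trans k0; apply: lerD; apply: mono.
have sumr : \sum_i (kappa i + kappa (rev_ord i)) = 0.
  by rewrite big_split /= sum0 add0r -[RHS]sum0 [RHS](reindex_inj rev_ord_inj).
move=> i; apply/eqP; rewrite -subr_eq0 opprK addrC.
by rewrite (psumr_eq0P (fun i _ => ge0 i) sumr).
Qed.

(** * Passing to [D2] and assembling the factorization *)

(** The permutation reverses the positions of nonzero index but fixes those of index 0, where [D2]
    is the identity and not antidiagonal. *)
Lemma D2_perm (F : fieldType) (d : nat) (kappa : 'I_d -> int) :
  (forall i, kappa (rev_ord i) = - kappa i) ->
  exists s : 'S_d, [/\ (s * s = 1)%g, forall i, kappa (s i) = - kappa i &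
    forall z : F, D2 kappa z = perm_mx s *m Dkappa kappa z].
Proof.
move=> kr; pose f i := if kappa i == 0 then i else rev_ord i.
have kf i : kappa (f i) = - kappa i.
  by rewrite /f; case: eqVneq => [->|]; rewrite ?oppr0 // kr.
have fK : involutive f.
  by move=> i; rewrite {1}/f kf oppr_eq0 /f; case: eqP => // _; rewrite rev_ordK.
exists (perm (inv_inj fK)); split=> [|i|z]; first 2 last.
(* The sum over columns is then split by the sign of the index; the negative ones match the second
   term of [D2] after reversal. *)
- have -> : perm_mx (perm (inv_inj fK)) *m Dkappa kappa z =
      \sum_j z ^ kappa j *: delta_mx (f j) j.
    apply/matrixP=> i j; rewrite -row_permE summxE !mxE permE (bigD1 j) //= !mxE.
    rewrite big1 ?addr0 => [|k kj]; last by rewrite !mxE [j == k]eq_sym (negPf kj) andbF mulr0.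
    rewrite eqxx andbT -(inj_eq (inv_inj fK)) fK.
    by case: eqVneq => [->|]; rewrite ?fK ?mulr1 ?mulr0.
  rewrite (bigID (fun j => 0 < kappa j)) /=.
  rewrite [X in _ = _ + X](bigID (fun j => kappa j == 0)) /= [X in _ = _ + X]addrC addrA.
  rewrite /D2 big_split /=; congr (_ + _ + _).
  + by apply: eq_bigr => j kj; rewrite /f gt_eqF.
  + rewrite [RHS](reindex_inj rev_ord_inj) /=; apply: eq_big => j.
      by rewrite kr; lia.
    by move=> kj; rewrite kr /f kr oppr_eq0 gt_eqF // rev_ordK.
  + apply: eq_big => j; first by lia.
    by move=> /eqP kj; rewrite kj expr0z scale1r /f kj eqxx.
- by apply/permP => i; rewrite permM !permE fK.
- by rewrite permE kf.
Qed.

Lemma symmetric_WH_factor (C : numClosedFieldType) (d : nat)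
    (P M : 'M[{poly C}]_d.+1) (kappa : 'I_d.+1 -> int) :
  (forall i j : 'I_d.+1, (i <= j)%N -> kappa j <= kappa i) ->
  (forall z : C, `|z| <= 1 -> evalmx P z \in unitmx) ->
  (forall z : C, `|z| <= 1 -> evalmx M z \in unitmx) ->
  (forall z, z != 0 -> evalmx P z *m Dkappa kappa z *m evalmx M z^-1 =
     (evalmx P z^-1 *m Dkappa kappa z^-1 *m evalmx M z)^T) ->
  exists Ap : 'M[{poly C}]_d.+1,
    (forall z : C, `|z| <= 1 -> evalmx Ap z \in unitmx) /\
    (forall z, z != 0 -> evalmx P z *m Dkappa kappa z *m evalmx M z^-1 =
       evalmx Ap z *m D2 kappa z *m (evalmx Ap z^-1)^T).
Proof.
move=> mono Pu Mu sym.
have [U [MU Usym]] := symmetric_WH_ratio C _ P M kappa Pu sym.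
have UD z : z != 0 ->
    evalmx U z *m Dkappa kappa z^-1 = Dkappa kappa z *m (evalmx U z^-1)^T.
  move=> z0; apply/matrixP=> i j; rewrite mulmx_Dkappa mul_Dkappa [(_^T) i j]mxE !evalmxE.
  by rewrite Usym // exprz_inv -mulrA -expfzDr // addrK mulrC.
have [z z1|Uu sum0] := reciprocal_det_const C _ U kappa _ UD.
  have := Mu z z1; rewrite -unitmx_tr -evalmx_tr MU evalmxM unitmx_mul.
  by case/andP.
have Udet : \det U != 0.
  by apply: contraTneq (Uu 0) => U0; rewrite unitmx_evalmx U0 horner0 eqxx.
have kr := antisymmetric_indices C _ U kappa mono Usym Udet sum0.
have [s [ss ks D2E]] := D2_perm C _ kappa kr.
set S := perm_mx s : 'M[C]_d.+1 in D2E.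
have SS : S *m S = 1%:M by rewrite -perm_mxM ss perm_mx1.
have ST : S^T = S by rewrite tr_perm_mx; congr perm_mx; apply: (mulgI s); rewrite mulgV ss.
have SD z : S *m Dkappa kappa z = Dkappa kappa z^-1 *m S.
  rewrite -row_permE; apply/matrixP=> i j.
  rewrite mul_Dkappa !mxE exprz_inv -ks; case: eqVneq => [->|]; rewrite ?mulr1 ?mulr0 //.
(* Since [S D(z) S = D(1/z)], this twist by [S] turns the relation [UD] into an intertwining of
   [V(z)] and [V(1/z)^T] by the single matrix [E z]. *)
pose V := U *m map_mx polyC S; pose E z := Dkappa kappa z *m S.
have VE z : evalmx V z = evalmx U z *m S by rewrite evalmxM evalmxC.
have VE_UD z : evalmx V z *m E z = evalmx U z *m Dkappa kappa z^-1.
  by rewrite VE /E -mulmxA [S *m _]mulmxA SD -!mulmxA SS mulmx1.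
have VEV z (z0 : z != 0) : evalmx V z *m E z = E z *m (evalmx V z^-1)^T.
  by rewrite VE_UD UD // VE trmx_mul ST /E -mulmxA [S *m (S *m _)]mulmxA SS mul1mx.
have Su : S \in unitmx by exact: unitmx_perm.
have Vu z : evalmx V z \in unitmx by rewrite VE unitmx_mul Uu.
have [|p pV] := sqrt_evalmx C _ V _ (Vu 0).
  apply: char_poly_evalmx_const => z z0.
  rewrite -[RHS]char_poly_tr; apply: char_poly_intertwine (VEV z z0).
  by rewrite unitmx_mul Dkappa_unit.
pose Q := horner_mx V (map_poly polyC p).
have QE z : evalmx Q z = horner_mx (evalmx V z) p by exact: evalmx_horner_mx.
have QEQ z : z != 0 -> evalmx Q z *m E z = E z *m (evalmx Q z^-1)^T.
  by move=> z0; rewrite !QE trmx_horner_mx; apply: horner_mx_intertwine; apply: VEV.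
have Qu z : evalmx Q z \in unitmx.
  by have := Vu z; rewrite -pV -QE unitmx_mul => /andP[].
(* [E = D S = S D2 S], so the two outer copies of [S] are absorbed into the factors. *)
exists (P *m Q *m map_mx polyC S); split=> [z z1|z z0].
  by rewrite !evalmxM evalmxC !unitmx_mul Pu ?Qu.
have -> : evalmx P z *m Dkappa kappa z *m evalmx M z^-1 =
    evalmx P z *m (evalmx V z *m E z) *m (evalmx P z^-1)^T.
  by rewrite VE_UD UD // -!mulmxA -trmx_mul -evalmxM -MU evalmx_tr trmxK.
have -> : evalmx V z *m E z = evalmx Q z *m E z *m (evalmx Q z^-1)^T.
  by rewrite -pV -QE -mulmxA -QEQ // mulmxA.
rewrite !evalmxM !evalmxC !trmx_mul ST D2E -/S /E !mulmxA.
by rewrite -[X in _ = X *m _ *m _ *m _ *m _]mulmxA SS mulmx1.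
Qed.

Theorem theorem3p5 (R : realType) (d : nat) (A : lmx R[i] d) (kappa : 'I_d -> int) :
  lmx_symmetric A ->
  (forall z : R[i], `|z| = 1 -> lmx_eval A z \in unitmx) ->
  std_WH A kappa ->
  exists Ap : 'M[{poly R[i]}]_d,
    (forall z : R[i], `|z| <= 1 -> evalmx Ap z \in unitmx) /\
    (forall z : R[i], z != 0 ->
       lmx_eval A z = evalmx Ap z *m D2 kappa z *m (evalmx Ap z^-1)^T).
Proof.
(* Polynomials in a matrix are formed in the ring of matrices of positive size, so size 0 is settled
   apart. *)
case: d A kappa => [|d] A kappa symA _ [mono [P [M [Pu [Mu AE]]]]].
  exists 0; split=> [z _|z _]; first by rewrite unitmxE det_mx00 unitr1.
  by apply/matrixP => -[].
have sym z (z0 : z != 0) : evalmx P z *m Dkappa kappa z *m evalmx M z^-1 =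
    (evalmx P z^-1 *m Dkappa kappa z^-1 *m evalmx M z)^T.
  have zV0 : z^-1 != 0 by rewrite invr_eq0.
  have AEV := AE _ zV0; rewrite invrK in AEV.
  by rewrite -(AE z z0) -AEV (symA z z0).
have [Ap [Apu ApE]] := symmetric_WH_factor _ d P M kappa mono Pu Mu sym.
by exists Ap; split=> // z z0; rewrite (AE z z0); apply: ApE.
Qed.
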